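(* Let $n,r$ be integers with $1\le r<n/2$, let $\delta$ be a real number with $\delta<\frac{1}{2rn^4}$, and let $G$ be an intersecting $r$-graph on $n$ vertices with $|G|>(1-\delta)\binom{n-1}{r-1}$. Then there is a vertex $v$ of $G$ such that all but at most $\delta r\binom{n-1}{r-1}$ edges of $G$ contain $v$.
   Context: An $r$-graph $G$ consists of a finite vertex set $V(G)$ and a set $E(G)$ of edges, each edge being an $r$-element subset of $V(G)$; $|G|=|E(G)|$. An $r$-graph is intersecting if every two of its edges have at least one common vertex. *)

(* Defs.v *)
(* MathComp; real numbers are elements of an arbitrary [realType]. *)
From mathcomp Require Export all_boot all_order all_algebra.
From mathcomp Require Export reals.

Set Implicit Arguments.
Unset Strict Implicit.
Unset Printing Implicit Defensive.

Record uniform_hypergraph (r : nat) := UniformHypergraph {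
  vertices : finType;
  edges : {set {set vertices}};
  edges_uniform : forall e : {set vertices}, e \in edges -> #|e| = r
}.

(* The two edges need not be distinct; for r > 0 an edge always meets itself,
   so this makes no difference. *)
Definition intersecting (r : nat) (G : uniform_hypergraph r) : Prop :=
  forall e f : {set vertices G},
    e \in edges G -> f \in edges G -> exists v, v \in e :&: f.

Definition edges_avoiding (r : nat) (G : uniform_hypergraph r) (v : vertices G) :
    {set {set vertices G}} :=
  [set e in edges G | v \notin e].

(* Main.v *)
Require Import Defs.
From mathcomp Require Import all_boot all_order all_algebra.
From mathcomp Require Import reals.
From mathcomp Require Import ring lra zify.

(** For an intersecting r-graph G on n vertices, the sets disjoint from some
    edge of G form, level by level, the iterated shadow of the complements of
    the edges; at level r they avoid G. Lovász's form of the Kruskal-Katona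
    theorem, proved by Keevash's induction on links, bounds the growth of these
    levels and gives Erdős-Ko-Rado.

    If |G| is nearly maximal, then summing over the vertices u the inequality
    between the degrees of u in levels r and r + 1 leaves almost no slack. But a
    vertex v of minimal degree at level r satisfies this inequality with a
    Lovász parameter slightly smaller than n - 2, and the resulting slack is too
    large unless the degree of v is below 'C(n - 3, r - 1). For such a v,
    Kruskal-Katona with parameter n - 3, applied to the edges avoiding v, shows
    that f such edges exclude at least f r / (r - 1) members of the full star of
    v, so f r / (r - 1) <= f + delta * 'C(n - 1, r - 1). *)

Set Implicit Arguments.
Unset Strict Implicit.
Unset Printing Implicit Defensive.

Import Order.TTheory GRing.Theory Num.Theory.
Local Open Scope ring_scope.

(** * Binomial coefficients with a real upper argument *)

Fixpoint rbin (R : realFieldType) (y : R) (k : nat) : R :=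
  if k is k'.+1 then y / k%:R * rbin (y - 1) k' else 1.

Lemma rbin_nat (R : realFieldType) (m k : nat) : rbin (m%:R : R) k = 'C(m, k)%:R.
Proof.
elim: k m => [|k IHk] [|m] /=; rewrite ?bin0 ?mul0r //.
rewrite -[in X in X - 1]natr1 addrK IHk mulrAC -natrM mul_bin_diag natrM mulrAC.
by rewrite mulfV ?mul1r // pnatr_eq0.
Qed.

(** Bernoulli's inequality: lowering the upper argument by [t] costs each of the [k] factors a
    proportion of at most [t / j.+1]. *)
Lemma rbin_sub_ge (R : realFieldType) (t : R) (k j : nat) :
  0 <= t <= 1 ->
  (1 - t * k%:R / j.+1%:R) * 'C(k + j, k)%:R <= rbin ((k + j)%:R - t) k.
Proof.
move=> /andP[t0 t1]; elim: k => [|k IHk] /=; first by rewrite mulr0 mul0r subr0 bin0 mul1r.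
have -> : (k.+1 + j)%:R - t - 1 = (k + j)%:R - t :> R by rewrite addSn -natr1; ring.
have K0 : 0 < k.+1%:R :> R by rewrite ltr0n.
have J0 : 0 < j.+1%:R :> R by rewrite ltr0n.
have -> : 'C(k.+1 + j, k.+1)%:R = (k.+1 + j)%:R / k.+1%:R * 'C(k + j, k)%:R :> R.
  apply: (mulfI (lt0r_neq0 K0)).
  rewrite -natrM -mul_bin_diag natrM addSn /=.
  by rewrite mulrA (mulrC k.+1%:R) divfK ?lt0r_neq0.
have c0 : 0 <= ((k.+1 + j)%:R - t) / k.+1%:R.
  rewrite divr_ge0 ?ler0n // subr_ge0 (le_trans t1) // ler1n; lia.
apply: le_trans (ler_wpM2l c0 IHk).
rewrite !mulrA; apply: ler_wpM2r; first exact: ler0n.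
rewrite [X in _ <= X]mulrAC; apply: ler_wpM2r; first by rewrite invr_ge0 ler0n.
have -> : (k.+1 + j)%:R = k%:R + j.+1%:R :> R by rewrite addSnnS natrD.
rewrite -natr1; set J := j.+1%:R in J0 *; set K : R := k%:R.
have K0' : 0 <= K by exact: ler0n.
rewrite -subr_ge0; move: J K J0 K0' {IHk c0} => J K J0 K0'.
have J1 : J != 0 by rewrite gt_eqF.
have -> : (K + J - t) * (1 - t * K / J) - (1 - t * (K + 1) / J) * (K + J)
  = t * K / J * (1 + t).
  by field.
by rewrite !mulr_ge0 ?invr_ge0 ?addr_ge0 // ltW.
Qed.

(** * Links, shadows and the Kruskal-Katona theorem *)

Section Families.
Variable T : finType.
Implicit Types (A D F : {set {set T}}) (u v : T) (s e : {set T}).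

Definition uniform_family (k : nat) D := forall s, s \in D -> #|s| = k.

Definition link u D : {set {set T}} := [set s :\ u | s in D & u \in s].

Lemma in_link u D s : (s \in link u D) = (u \notin s) && (u |: s \in D).
Proof.
apply/imsetP/andP => [[e]|[us usD]].
  by rewrite inE => /andP[eD ue] ->; rewrite setD1K // eD setD11.
by exists (u |: s); rewrite ?inE ?usD ?eqxx //= setU1K.
Qed.

Lemma card_link u D : #|link u D| = #|[set s in D | u \in s]|.
Proof.
rewrite card_in_imset // => s e; rewrite !inE => /andP[_ us] /andP[_ ue] eq_se.
by rewrite -(setD1K us) eq_se setD1K.
Qed.

Lemma sum_card_link D k :
  uniform_family k D -> (\sum_u #|link u D| = k * #|D|)%N.
Proof.
move=> Dk.
have -> : (\sum_u #|link u D| = \sum_u \sum_(s in D) (u \in s))%N.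
  apply: eq_bigr => u _; rewrite card_link -sum1_card [RHS]big_mkcond /=.
  rewrite big_mkcond; apply: eq_bigr => s _; rewrite inE.
  by case: (s \in D) => //=; case: (u \in s).
rewrite exchange_big /= mulnC -sum_nat_const; apply: eq_bigr => s sD.
by rewrite -(Dk s sD) -sum1_card [RHS]big_mkcond; apply: eq_bigr => u _; case: ifP.
Qed.

Definition shadow_in A D := forall a u, a \in A -> u \in a -> a :\ u \in D.

Lemma shadow_in_link A D u : shadow_in A D -> shadow_in (link u A) (link u D).
Proof.
move=> AD a w; rewrite !in_link => /andP[ua uaA] wa.
have uw : u != w by apply: contraNneq ua => ->.
rewrite in_setD1 negb_and ua orbT /=.
have -> : u |: a :\ w = (u |: a) :\ w.
  by apply/setP => z; rewrite !inE; case: (eqVneq z u) => // ->; rewrite uw.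
by apply: AD => //; rewrite !inE wa orbT.
Qed.

(** Deleting [u] from a member of [A] gives a member of [D] without [u], while [link u D] counts the
    members of [D] that contain [u]. *)
Lemma card_link_shadow A D u :
  shadow_in A D -> (#|link u A| + #|link u D| <= #|D|)%N.
Proof.
move=> AD; rewrite [X in (_ + X)%N]card_link -(cardsID [set s : {set T} | u \in s] D) addnC.
have -> : D :&: [set s : {set T} | u \in s] = [set s in D | u \in s].
  by apply/setP=> s; rewrite !inE.
rewrite leq_add2l; apply/subset_leq_card/subsetP => s.
rewrite in_link !inE => /andP[us usA]; rewrite us /=.
by rewrite -(setU1K us) AD // setU11.
Qed.

Lemma link_uniform D k u :
  uniform_family k.+1 D -> uniform_family k (link u D).
Proof.
move=> Dk s; rewrite in_link => /andP[us /Dk].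
by rewrite cardsU1 us => -[].
Qed.

(** The links satisfy the inequality with [k] and [y] lowered by one; summing over all vertices
    counts each set once per element. *)
Lemma lovasz_kruskal_katona (R : realFieldType) (k : nat) (y : R) A D :
  uniform_family k.+1 A -> uniform_family k D ->
  shadow_in A D -> k%:R <= y -> #|D|%:R < rbin y k ->
  k.+1%:R * #|A|%:R <= (y - k%:R) * #|D|%:R.
Proof.
elim: k y A D => [|k IHk] y A D Ak Dk AD ky /=.
  rewrite (ltr_nat R _ 1) ltnS leqn0 cards_eq0 => /eqP D0; suff -> : A = set0 by rewrite D0 !cards0 !mulr0.
  apply/eqP/set0Pn => -[a aA]; have /eqP/cards1P[u au] := Ak a aA.
  by have := AD a u aA; rewrite D0 inE au set11 => /(_ isT).
move=> Dlt.
have K0 : 0 < k.+1%:R :> R by rewrite ltr0n.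
have y0 : 0 <= y by exact: le_trans (ltW K0) ky.
have Pu u : k.+1%:R * #|link u A|%:R <= (y - k.+1%:R) * #|link u D|%:R :> R.
  have [Du|Du] := ltP #|link u D|%:R (rbin (y - 1) k).
    have -> : y - k.+1%:R = y - 1 - k%:R by rewrite -natr1; ring.
    apply: IHk => //; try exact: link_uniform.
    - exact: shadow_in_link.
    - by rewrite lerBrDr natr1.
  (* A heavy link needs no induction: [k.+1 * #|D| < y * #|link u D|], and [link u A] fits into the
     rest of [D]. *)
  have: (#|link u A|%:R + #|link u D|%:R <= #|D|%:R :> R).
    by rewrite -natrD ler_nat card_link_shadow.
  move: Dlt; rewrite mulrAC ltr_pdivlMr // => Dlt sumle.
  have := ler_wpM2l y0 Du; have := ler_wpM2l (ltW K0) sumle; lra.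
have : \sum_u k.+1%:R * #|link u A|%:R <= \sum_u (y - k.+1%:R) * #|link u D|%:R :> R.
  by apply: ler_sum => u _; exact: Pu.
rewrite -!mulr_sumr -!natr_sum (sum_card_link Ak) (sum_card_link Dk) !natrM.
by rewrite [X in _ <= X]mulrCA ler_pM2l.
Qed.

(** * Levels of missed sets and the Erdős-Ko-Rado theorem *)

(** The level-[j] part of the iterated shadow of the complements of the members
    of [F]. *)
Definition missed F (j : nat) : {set {set T}} :=
  [set s : {set T} | (#|s| == j) && [exists e in F, [disjoint s & e]]].

Lemma missedP F j s :
  reflect (#|s| = j /\ exists2 e, e \in F & [disjoint s & e]) (s \in missed F j).
Proof.
rewrite inE; apply: (iffP andP) => -[/eqP sj].
  by move=> /exists_inP[e eF se]; split; last exists e.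
by case=> e eF se; rewrite sj; split=> //; apply/exists_inP; exists e.
Qed.

Lemma missed_uniform F j : uniform_family j (missed F j).
Proof. by move=> s /missedP[]. Qed.

Lemma missed_shadow F j : shadow_in (missed F j.+1) (missed F j).
Proof.
move=> s u /missedP[sj [e eF se]] us; apply/missedP; split.
  by move: (cardsD1 u s); rewrite us sj => -[].
by exists e => //; apply: disjointWl se; rewrite subD1set.
Qed.

Lemma card_missed_compl F t :
  uniform_family t F -> (#|F| <= #|missed F (#|T| - t)|)%N.
Proof.
move=> Ft; rewrite -(card_imset _ (can_inj (@setCK T))).
apply/subset_leq_card/subsetP => _ /imsetP[e eF ->]; apply/missedP; split.
  by rewrite -(Ft e eF) -(cardsC e) addKn.
by exists e => //; rewrite -setI_eq0 setIC setICr.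
Qed.

(** The ratio of [#|missed F j|] to ['C(x, j)] starts below one, so Kruskal-Katona applies with
    [y = x]; it does not increase, so the next level is again admissible. *)
Lemma missed_chain F x a i :
  (a + i <= x)%N -> (#|missed F a| < 'C(x, a))%N ->
  (#|missed F (a + i)| * 'C(x, a) <= #|missed F a| * 'C(x, a + i))%N.
Proof.
move=> aix alt; elim: i aix => [|i IHi] aix; first by rewrite addn0.
have {}IHi := IHi ltac:(lia).
have a0 : (0 < 'C(x, a))%N by exact: leq_trans alt.
have ai0 : (0 < 'C(x, a + i))%N by rewrite bin_gt0; lia.
have ilt : (#|missed F (a + i)| < 'C(x, a + i))%N.
  rewrite -(ltn_pmul2r a0); apply: leq_ltn_trans IHi _.
  by rewrite mulnC ltn_pmul2l.
have := @lovasz_kruskal_katona rat (a + i) x%:R (missed F (a + i.+1)) (missed F (a + i)).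
rewrite addnS rbin_nat !ltr_nat !ler_nat -natrB; last by lia.
rewrite -!natrM ler_nat.
move=> /(_ (@missed_uniform _ _) (@missed_uniform _ _) (@missed_shadow _ _)
  ltac:(lia) ilt) step.
rewrite -(leq_pmul2l (ltn0Sn (a + i))).
have := mul_bin_left x (a + i).
nia.
Qed.

Lemma card_chain F t x a :
  uniform_family t F -> (a <= #|T| - t <= x)%N ->
  (#|missed F a| < 'C(x, a))%N ->
  (#|F| * 'C(x, a) <= #|missed F a| * 'C(x, #|T| - t))%N.
Proof.
move=> Ft /andP[at_ tx] alt.
have := @missed_chain F x a (#|T| - t - a); rewrite subnKC // => /(_ tx alt).
by apply: leq_trans; rewrite leq_mul2r card_missed_compl ?orbT.
Qed.

Definition intersecting_family F :=
  forall e f, e \in F -> f \in F -> ~~ [disjoint e & f].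

Lemma card_missed_intersecting F r :
  uniform_family r F -> intersecting_family F ->
  (#|F| + #|missed F r| <= 'C(#|T|, r))%N.
Proof.
move=> Fr FI; rewrite -card_draws -cardsUI.
have -> : F :&: missed F r = set0.
  apply/setP => s; rewrite in_setI in_set0; apply/negbTE/andP => -[sF /missedP[_ [e eF]]].
  by apply/negP/FI.
rewrite cards0 addn0; apply/subset_leq_card/subsetP => s; rewrite !inE.
by case/orP=> [/Fr->|/andP[]].
Qed.

(** No edge is a missed set, so the two links are disjoint families of [r]-subsets of [[set~ v]]. *)
Lemma card_star_missed F r v :
  uniform_family r.+1 F -> intersecting_family F ->
  (#|[set e in F | v \in e]| + #|link v (missed F r.+1)| <= 'C(#|T|.-1, r))%N.
Proof.
move=> Fr FI; rewrite -card_link -cardsUI.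
have -> : link v F :&: link v (missed F r.+1) = set0.
  apply/setP => s; rewrite in_setI in_set0 !in_link; apply/negbTE/negP.
  move=> /andP[/andP[_ sF]] /andP[_ /missedP[_ [e eF]]].
  by apply/negP/FI.
have <- : #|[set~ v]| = #|T|.-1 by rewrite cardsC1.
rewrite cards0 addn0 -cards_draws; apply/subset_leq_card/subsetP => s.
rewrite in_setU !in_link => H; rewrite inE subsetC sub1set inE.
have [vs vsr] : v \notin s /\ #|v |: s| = r.+1.
  by case/orP: H => /andP[-> H]; split=> //; [apply: Fr|case/missedP: H].
by move: vsr; rewrite cardsU1 vs add1n => -[->]; rewrite eqxx.
Qed.

Lemma erdos_ko_rado F r :
  (0 < r)%N -> (2 * r <= #|T|)%N -> uniform_family r F -> intersecting_family F ->
  (#|F| <= 'C(#|T|.-1, r.-1))%N.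
Proof.
case: r => // r _; case En : #|T| => [|n] //= rn Fr FI.
have := card_missed_intersecting Fr FI; rewrite En binS.
(* If the level is this large, Pascal's rule bounds [F]. Otherwise the chain with [x = n] ends at
   level [n - r], and ['C(n, n - r) = 'C(n, r)]. *)
have [le|lt] := leqP 'C(n, r.+1) #|missed F r.+1|.
  by move: le; move: #|F| #|missed F r.+1| 'C(n, r.+1) 'C(n, r) => f d c1 c; lia.
have := card_chain Fr _ lt; rewrite En => /(_ ltac:(lia)).
have -> : 'C(n, n.+1 - r.+1) = 'C(n, r) by rewrite subSS bin_sub //; lia.
move: lt; move: #|F| #|missed F r.+1| 'C(n, r.+1) 'C(n, r) => f d c1 c; nia.
Qed.

(** * Level sizes and a light vertex for a nearly maximal family *)

Lemma card_missed_ub (R : realFieldType) F (r n : nat) (delta : R) :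
  #|T| = n.+2 -> (2 * r < n)%N -> 0 <= delta ->
  uniform_family r.+1 F -> intersecting_family F ->
  (1 - delta) * 'C(n.+1, r)%:R <= #|F|%:R ->
  r.+1%:R * #|missed F r.+1|%:R <= (1 + delta) * (n.+1%:R * 'C(n, r)%:R).
Proof.
move=> Tn rn d0 Fr FI Fge.
have := card_missed_intersecting Fr FI; rewrite Tn binS -(ler_nat R) (natrD R #|F|) (natrD R (binomial _ _)) => Dle.
have C1E : r.+1%:R * 'C(n.+1, r.+1)%:R = n.+1%:R * 'C(n, r)%:R :> R.
  by rewrite -!natrM -mul_bin_diag.
have CE : r.+1%:R * 'C(n.+1, r)%:R <= n.+1%:R * 'C(n, r)%:R :> R.
  by rewrite -!natrM (mul_bin_down n.+1 r) ler_nat leq_mul2r; apply/orP; right; lia.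
have := ler_wpM2l (ler0n R r.+1) (lerD Dle Fge); have := ler_wpM2l d0 CE. lra.
Qed.

(** The chain with [x = n.+1] carries the density of [F] to level [r.+2], where a full star has
    ['C(n.+1, r.+2)] missed sets. The factor [n.+1 * 'C(n, r)] matches [card_missed_ub], for
    comparison. *)
Lemma card_missed_lb (R : realFieldType) F (r n : nat) (delta : R) :
  #|T| = n.+2 -> (2 * r < n)%N -> 0 <= delta -> uniform_family r.+1 F ->
  (1 - delta) * 'C(n.+1, r)%:R <= #|F|%:R ->
  (1 - delta) * ((n - r)%:R * (n.+1%:R * 'C(n, r)%:R))
    <= r.+1%:R * (r.+2%:R * #|missed F r.+2|%:R).
Proof.
move=> Tn rn d0 Fr Fge.
have C2E : (n - r)%:R * (n.+1%:R * 'C(n, r)%:R) =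
    r.+1%:R * (r.+2%:R * 'C(n.+1, r.+2)%:R) :> R.
  by rewrite -!natrM (mul_bin_diag n.+1) (mul_bin_left _ r.+1) subSS mulnCA.
rewrite C2E [X in X <= _]mulrCA ler_pM2l ?ltr0n // [X in X <= _]mulrCA ler_pM2l ?ltr0n //.
have [le|lt] := leqP 'C(n.+1, r.+2) #|missed F r.+2|.
  rewrite -(ler_nat R) in le; apply: le_trans le.
  by rewrite -[X in _ <= X]mul1r ler_wpM2r ?ler0n // gerBl.
have := card_chain Fr _ lt; rewrite Tn => /(_ ltac:(lia)).
have -> : 'C(n.+1, n.+2 - r.+1) = 'C(n.+1, r) by rewrite subSS -bin_sub; [congr binomial|]; lia.
have C0 : 0 < 'C(n.+1, r)%:R :> R by rewrite ltr0n bin_gt0; lia.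
rewrite -(ler_nat R) !natrM => le.
rewrite -(ler_pM2r C0) mulrAC; apply: le_trans le.
by rewrite ler_wpM2r.
Qed.

Lemma exists_light_vertex (R : realFieldType) F (r n : nat) (delta : R) :
  #|T| = n.+2 -> (0 < r)%N -> (2 * r < n)%N -> 0 <= delta ->
  12%:R * n.+2%:R ^+ 3 * delta < 1 ->
  uniform_family r.+1 F -> intersecting_family F ->
  (1 - delta) * 'C(n.+1, r)%:R <= #|F|%:R ->
  exists v, (#|link v (missed F r.+1)| < 'C(n.-1, r))%N.
Proof.
move=> Tn r0 rn d0 dlt Fr FI Fge.
have Dle := card_missed_ub Tn rn d0 Fr FI Fge.
have Age := card_missed_lb Tn rn d0 Fr Fge.
have := card_missed_intersecting Fr FI; rewrite Tn binS -(ler_nat R) (natrD R #|F|) (natrD R (binomial _ _)) => sumle.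
have CE : r.+1%:R * 'C(n.+1, r)%:R <= n.+1%:R * 'C(n, r)%:R :> R.
  by rewrite -!natrM (mul_bin_down n.+1 r) ler_nat leq_mul2r; apply/orP; right; lia.
have C1E : r.+1%:R * 'C(n.+1, r.+1)%:R = n.+1%:R * 'C(n, r)%:R :> R.
  by rewrite -!natrM -mul_bin_diag.
have C3E : n%:R * 'C(n.-1, r)%:R = (n - r)%:R * 'C(n, r)%:R :> R.
  by rewrite -!natrM mul_bin_down.
set D := missed F r.+1 in Dle sumle *; set A := missed F r.+2 in Age.
have AD : shadow_in A D by exact: missed_shadow.
have Ak : uniform_family r.+2 A by exact: missed_uniform.
have Dk : uniform_family r.+1 D by exact: missed_uniform.
have M0 : 0 < 'C(n, r)%:R :> R by rewrite ltr0n bin_gt0; lia.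
move: Dle Age CE C1E C3E M0; set M : R := 'C(n, r)%:R.
move=> Dle Age CE C1E C3E M0.
(* [Q] is the excess that [card_missed_ub] allows over the full star. *)
have [Q QE] : {Q | Q = delta * (n.+1%:R * M)} by exists (delta * (n.+1%:R * M)).
have rlen : (r < n)%N by move: rn; clear; lia.
have PE : (n - r)%:R = n%:R - r%:R :> R by rewrite natrB // ltnW.
have Q0 : 0 <= Q by rewrite QE !mulr_ge0 ?ler0n // ltW.
have all_u u : r.+1%:R * #|link u A|%:R <= (n - r)%:R * #|link u D|%:R + Q :> R.
  (* Light links obey Kruskal-Katona with [y = n]; for heavy ones, the bound on [#|D|] suffices up
     to [Q]. *)
  have [light|heavy] := ltP (#|link u D|%:R : R) M.
    apply: ler_wpDr => //; rewrite PE.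
    apply: (lovasz_kruskal_katona (link_uniform Ak) (link_uniform Dk)).
    - exact: shadow_in_link.
    - by rewrite ler_nat; move: rn; clear; lia.
    - by rewrite rbin_nat.
  have := card_link_shadow u AD; rewrite -(ler_nat R) natrD => le.
  have h1 := ler_wpM2l (ler0n R r.+1) (lerD (lerD le sumle) Fge).
  have h2 := ler_wpM2l d0 CE.
  have h3 := ler_wpM2l (ler0n R n.+1) heavy.
  by move: h1 h2 h3 C1E; rewrite PE QE; clear; lra.
have [v minv] : exists v, forall u, (#|link v D| <= #|link u D|)%N.
  have /card_gt0P[x _] : (0 < #|T|)%N by rewrite Tn.
  by case: (arg_minnP (fun u => #|link u D|) (erefl true : xpredT x)) => v _ minv; exists v => u; apply: minv.
exists v; rewrite ltnNge; apply/negP; rewrite -(ler_nat R) => dge.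
have nd : n.+2%:R * #|link v D|%:R <= r.+1%:R * #|D|%:R :> R.
  rewrite -!natrM ler_nat -(sum_card_link Dk) -Tn -sum_nat_const.
  by apply: leq_sum => u _.
(* The average degree is at most [(1 + delta) * n.+1 / n.+2 * M]. Giving up half of the gap
   [1 / n.+2] absorbs [delta], so the minimum is below [(1 - t) * M]. *)
pose t : R := (2%:R * n.+2%:R)^-1.
have n2 : 0 < n.+2%:R :> R by rewrite ltr0n.
have t0 : 0 < t by rewrite invr_gt0 mulr_gt0.
have tE : 2%:R * n.+2%:R * t = 1 by rewrite mulfV // gt_eqF // mulr_gt0.
have tle : t * n.+2%:R = 1 / 2 by move: tE; clear; lra.
have t1 : t <= 1 by rewrite invf_le1 ?mulr_gt0 // -natrM ler1n.
have dn : 12 * (delta * n.+1%:R) < 1.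
  apply: le_lt_trans dlt; rewrite -mulrA; apply: ler_wpM2l; first exact: ler0n.
  by rewrite mulrC; apply: ler_wpM2r => //; rewrite -natrX ler_nat; clear; lia.
have dM : #|link v D|%:R < (1 - t) * M.
  rewrite -(ltr_pM2l n2); apply: (le_lt_trans nd); apply: (le_lt_trans Dle).
  have -> : n.+2%:R * ((1 - t) * M) = (n.+1%:R + 1 - t * n.+2%:R) * M by rewrite natr1; ring.
  have -> : (1 + delta) * (n.+1%:R * M) = (n.+1%:R + delta * n.+1%:R) * M by ring.
  by rewrite ltr_pM2r // tle; move: dn; clear; lra.
have lv : r.+1%:R * #|link v A|%:R <= (n%:R - t - r%:R) * #|link v D|%:R.
  apply: (lovasz_kruskal_katona (link_uniform Ak) (link_uniform Dk)).
  - exact: shadow_in_link.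
  - by rewrite lerBrDr (@le_trans _ _ (r%:R + 1)) ?lerD2l // natr1 ler_nat.
  - apply: (lt_le_trans dM).
    (* As [r <= (n - r).+1], the loss factor is at least [1 - t]. *)
    have := @rbin_sub_ge R t r (n - r); rewrite subnKC ?(ltnW rlen) //.
    rewrite t1 ltW // => /(_ isT); apply: le_trans; rewrite ler_wpM2r ?ler0n // lerD2l lerN2.
    rewrite ler_pdivrMr ?ltr0n //; apply: ler_wpM2l; first exact: ltW.
    by rewrite ler_nat; move: rn; clear; lia.
(* The parameter [n - t] saves [t * #|link v D|] in the term of [v]. *)
have : \sum_u r.+1%:R * #|link u A|%:R <=
       \sum_u ((n - r)%:R * #|link u D|%:R + Q - (u == v)%:R * (t * #|link v D|%:R)) :> R.
  apply: ler_sum => u _; case: eqVneq => [->|_]; last by rewrite mul0r subr0.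
  by move: lv Q0; rewrite PE mul1r; clear; lra.
rewrite sumrB big_split /= -!mulr_sumr -!natr_sum (sum_card_link Ak) (sum_card_link Dk).
rewrite sumr_const Tn -mulr_suml (bigD1 v) //= eqxx big1 ?addr0 ?mul1r; last first.
  by move=> u /negbTE ->.
rewrite (natrM R r.+2) (natrM R r.+1) -[Q *+ _]mulr_natl => total.
have P0 : 0 <= (n - r)%:R :> R by exact: ler0n.
have PQ : (n - r)%:R * Q <= n.+2%:R * Q.
  by apply: ler_wpM2r => //; rewrite ler_nat; clear; lia.
(* The two level bounds leave a slack of [2 * (n - r) * Q], and the [n.+2] vertices add one [Q]
   each. *)
have key : t * #|link v D|%:R <= 3 * (n.+2%:R * Q).
  have := ler_wpM2l P0 Dle; move: total Age PQ; rewrite QE; clear; lra.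
have M2d : M <= 2 * #|link v D|%:R.
  have n0 : 0 < n%:R :> R by rewrite ltr0n; move: rn; clear; lia.
  have Pn : n%:R <= 2 * (n - r)%:R :> R by rewrite -natrM ler_nat; move: rn; clear; lia.
  rewrite -(ler_pM2l n0).
  have := ler_wpM2r (ltW M0) Pn; have := ler_wpM2l (ltW n0) dge; rewrite C3E; clear; lra.
have Qsmall : 12 * (n.+2%:R ^+ 2 * Q) < M.
  rewrite -[X in _ < X]mul1r; apply: (@le_lt_trans _ _ (12 * n.+2%:R ^+ 3 * delta * M)).
    have -> : 12 * n.+2%:R ^+ 3 * delta * M = 12 * (n.+2%:R ^+ 2 * (delta * (n.+2%:R * M))).
      by ring.
    rewrite QE !ler_wpM2l ?exprn_ge0 ?ler0n // ler_wpM2r ?(ltW M0) // ler_nat //.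
  by rewrite ltr_pM2r.
(* Since [t * n.+2 = 1 / 2], this gives [#|link v D| <= 6 * n.+2 ^ 2 * Q < M / 2 <= #|link v D|];
   hence the constant 12. *)
have := ler_wpM2l (ltW n2) key.
have -> : n.+2%:R * (t * #|link v D|%:R) = (t * n.+2%:R) * #|link v D|%:R by ring.
by rewrite tle; move: M2d Qsmall; clear; lra.
Qed.

(** * Edges outside a star, and stability *)

Lemma few_edges_outside_star F (r n : nat) v :
  #|T| = n.+2 -> (0 < r)%N -> (2 * r < n)%N ->
  uniform_family r.+1 F ->
  (#|link v (missed F r.+1)| < 'C(n.-1, r))%N ->
  (#|[set e in F | v \notin e]| * r.+1 <= #|link v (missed F r.+1)| * r)%N.
Proof.
move=> Tn r0 rn Fr light.
(* Adding [v] to these edges turns the link of [v] at level [r.+1] into level [r] of [F'], where the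
   chain applies with [x = n.-1]. *)
pose F' := [set v |: e | e in F & v \notin e].
have cF' : #|F'| = #|[set e in F | v \notin e]|.
  rewrite card_in_imset // => e f; rewrite !inE => /andP[_ ve] /andP[_ vf] eq_ef.
  by rewrite -(setU1K ve) eq_ef setU1K.
have F'r : uniform_family r.+2 F'.
  move=> s /imsetP[e]; rewrite inE => /andP[eF ve] ->.
  by rewrite cardsU1 ve (Fr e eF).
have mF' : missed F' r = link v (missed F r.+1).
  apply/setP => s; rewrite in_link; apply/missedP/andP.
    case=> sr [f /imsetP[e]]; rewrite inE => /andP[eF ve] ->.
    rewrite disjoint_sym disjoints_subset subUset sub1set inE => /andP[vs es].
    split=> //; apply/missedP; rewrite cardsU1 vs sr; split=> //; exists e => //.
    by rewrite disjoint_sym disjoints_subset setCU subsetI es andbT subsetC sub1set inE.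
  case=> vs /missedP[]; rewrite cardsU1 vs add1n => -[sr] [e eF].
  rewrite disjoints_subset subUset sub1set inE => /andP[ve se]; split=> //.
  exists (v |: e); first by apply: imset_f; rewrite inE eF.
  by rewrite disjoints_subset setCU subsetI se andbT subsetC sub1set inE.
rewrite -mF' in light *; rewrite -cF'.
have := card_chain F'r _ light; rewrite Tn !subSS => /(_ ltac:(lia)).
have -> : 'C(n.-1, n - r) = 'C(n.-1, r.-1).
  by rewrite -bin_sub; [congr binomial|]; lia.
have := mul_bin_left n.-1 r.-1; rewrite prednK // => binE.
have c0 : (0 < 'C(n.-1, r))%N by rewrite bin_gt0; lia.
move: binE c0; move: 'C(n.-1, r) 'C(n.-1, r.-1) #|F'| #|missed F' r| => c c' f d binE c0 le.
have le2 : (f * (n.-1 - r.-1) <= d * r)%N.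
  rewrite -(leq_pmul2l c0).
  have -> : (c * (d * r) = d * (r * c))%N by lia.
  rewrite binE; move: le; clear; nia.
(* The factor on the left is [n - r], at least [r.+1] because [2 * r < n]. *)
apply: leq_trans le2; rewrite leq_mul2l; apply/orP; right; lia.
Qed.

Lemma intersecting_stability (R : realFieldType) F (r n : nat) (delta : R) :
  #|T| = n -> (0 < r)%N -> (2 * r < n)%N -> delta < 1 / (2 * r%:R * n%:R ^+ 4) ->
  uniform_family r F -> intersecting_family F ->
  (1 - delta) * 'C(n.-1, r.-1)%:R < #|F|%:R ->
  exists v, #|[set e in F | v \notin e]|%:R <= delta * r%:R * 'C(n.-1, r.-1)%:R.
Proof.
move=> Tn r0 rn dlt Fr FI Fgt.
(* A negative [delta] would contradict Erdős-Ko-Rado. *)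
have d0 : 0 <= delta.
  have EKR : (#|F| <= 'C(n.-1, r.-1))%N.
    by rewrite -Tn; apply: erdos_ko_rado => //; rewrite Tn ltnW.
  have C0 : 0 < 'C(n.-1, r.-1)%:R :> R by rewrite ltr0n bin_gt0; lia.
  rewrite -(ler_nat R) in EKR; have := lt_le_trans Fgt EKR.
  by rewrite gtr_pMl // ltrBlDr ltrDl => /ltW.
case: r r0 rn dlt Fr Fgt => [//|[|r]] _ rn dlt Fr Fgt.
  (* For edges of size one, intersecting means equal, so one edge determines [v]. *)
  have [e eF] : exists e, e \in F.
    apply/set0Pn; apply: contraTneq Fgt => ->; rewrite cards0 bin0 mulr1 -leNgt subr_ge0.
    apply: le_trans (ltW dlt) _; rewrite mulr1 ler_pdivrMr ?mul1r.
      by rewrite -natrX -natrM ler1n muln_gt0 expn_gt0 (leq_ltn_trans _ rn).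
    by rewrite mulr_gt0 // exprn_gt0 // ltr0n (leq_ltn_trans _ rn).
  have /eqP/cards1P[v ev] := Fr e eF; exists v.
  suff -> : [set e in F | v \notin e] = set0 by rewrite cards0 !mulr_ge0.
  apply/setP => f; rewrite !inE; apply/negbTE/negP => /andP[fF].
  by have := FI e f eF fF; rewrite ev disjoints1 negbK => ->.
case: n Tn rn dlt Fgt => [|[|n]] //= Tn rn dlt Fgt.
have rn' : (2 * r.+1 < n)%N by move: rn; clear; lia.
(* Here [n.+2 >= 5] and edges have size [r.+2 >= 2], so [2 * r.+2 * n.+2 >= 12]. *)
have d12 : 12 * n.+2%:R ^+ 3 * delta < 1.
  move: dlt; rewrite ltr_pdivlMr; last by rewrite !mulr_gt0 ?exprn_gt0 ?ltr0n.
  apply: le_lt_trans; rewrite mulrC ler_wpM2l // -!natrX -!natrM ler_nat.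
  rewrite (expnSr _ 3) mulnA mulnAC leq_mul2r; apply/orP; right.
  by move: rn; clear; nia.
have [v vlight] := exists_light_vertex Tn (ltn0Sn r) rn' d0 d12 Fr FI (ltW Fgt).
exists v.
have := card_star_missed v Fr FI; rewrite Tn /=.
have := few_edges_outside_star Tn (ltn0Sn r) rn' Fr vlight.
have : #|F| = (#|[set e in F | v \in e]| + #|[set e in F | v \notin e]|)%N.
  rewrite -(cardsID [set e : {set T} | v \in e] F); congr (_ + _)%N;
    by apply: eq_card => e; rewrite !inE // andbC.
move: #|[set e in F | v \in e]| => s.
move: (#|[set e in F | v \notin e]|) (#|link v (missed F r.+2)|) => f d FE fd sd.
move: Fgt fd sd; rewrite FE -(ler_nat R) -[(s + d <= _)%N](ler_nat R) !natrM !(natrD R s).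
move=> Fgt fd sd.
have r0 : 0 <= r.+1%:R :> R by exact: ler0n.
(* Eliminating [s] bounds [d] above in terms of [f]; with [fd] this yields
   [f <= delta * r.+1 * 'C(n.+1, r.+1)]. *)
have : d%:R <= delta * 'C(n.+1, r.+1)%:R + f%:R :> R by move: Fgt sd; clear; lra.
move=> /(ler_wpM2l r0) dle.
have : 0 <= delta * 'C(n.+1, r.+1)%:R by rewrite mulr_ge0.
by move: dle fd; clear; lra.
Qed.

End Families.

Theorem theorem4 (R : realType) (n r : nat) (delta : R) (G : uniform_hypergraph r)
    (r_ge1 : (1 <= r)%N)
    (r_lt_half : (2 * r < n)%N)
    (delta_lt : delta < 1 / (2 * r%:R * n%:R ^+ 4))
    (card_vertices : #|vertices G| = n)
    (G_intersecting : intersecting G)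
    (G_large : (1 - delta) * 'C(n.-1, r.-1)%:R < #|edges G|%:R) :
  exists v : vertices G,
    #|edges_avoiding v|%:R <= delta * r%:R * 'C(n.-1, r.-1)%:R.
Proof.
apply: intersecting_stability => //; first exact: edges_uniform.
by move=> e f eG fG; rewrite -setI_eq0; apply/set0Pn; exact: G_intersecting.
Qed.
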